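(* The triple $(\mathcal{R}_1,\le,r)$ is a topological Ramsey space: with respect to the Ellentuck topology on $\mathcal{R}_1$, every subset of $\mathcal{R}_1$ with the property of Baire is Ramsey, and every meager subset of $\mathcal{R}_1$ is Ramsey null.
   Context: Let $\mathbb{T}=\{\langle\rangle\}\cup\{\langle n\rangle:n<\omega\}\cup\{\langle n,i\rangle:n<\omega,\ i\le n\}$ and $\mathbb{T}(n)=\{\langle\rangle,\langle n\rangle\}\cup\{\langle n,i\rangle:i\le n\}$. A set $X\subseteq\mathbb{T}$ belongs to $\mathcal{R}_1$ iff there are a strictly increasing sequence $(k_n)_{n<\omega}$ and sets $L_n\subseteq\{0,\dots,k_n\}$ with $|L_n|=n+1$ such that $X=\{\langle\rangle\}\cup\bigcup_{n<\omega}(\{\langle k_n\rangle\}\cup\{\langle k_n,i\rangle:i\in L_n\})$; then $X(n)=\{\langle\rangle,\langle k_n\rangle\}\cup\{\langle k_n,i\rangle:i\in L_n\}$ is the $n$-th tree of $X$. The approximation maps are $r_0(X)=\emptyset$ and $r_n(X)=\bigcup_{i<n}X(i)$; $\mathcal{AR}_n=\{r_n(X):X\in\mathcal{R}_1\}$, $\mathcal{AR}=\bigcup_n\mathcal{AR}_n$. The order is $Y\le X$ iff $Y\subseteq X$ (equivalently, each $Y(n)$ is a subtree of some $X(k_n)$ with $(k_n)$ strictly increasing). For $a\in\mathcal{AR}$, $a\sqsubseteq X$ means $a=r_n(X)$ for some $n$. The Ellentuck topology on $\mathcal{R}_1$ has basic open sets $[a,B]=\{X\in\mathcal{R}_1: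 a\sqsubseteq X,\ X\le B\}$ for $a\in\mathcal{AR}$, $B\in\mathcal{R}_1$; nowhere dense, meager, and property of Baire are taken with respect to this topology. A set $\mathcal{X}\subseteq\mathcal{R}_1$ is Ramsey if for every nonempty $[a,A]$ there is $B\in[a,A]$ with $[a,B]\subseteq\mathcal{X}$ or $[a,B]\cap\mathcal{X}=\emptyset$; it is Ramsey null if for every nonempty $[a,A]$ there is $B\in[a,A]$ with $[a,B]\cap\mathcal{X}=\emptyset$. *)

(* Defs.v *)
From HB Require Import structures.
From mathcomp Require Import all_boot.
From mathcomp Require Import all_classical.
From mathcomp Require Import topology.

Set Implicit Arguments.
Unset Strict Implicit.
Unset Printing Implicit Defensive.

Local Open Scope classical_set_scope.

Definition TT : set (seq nat) :=
  [set [::]] `|` [set s | exists n : nat, s = [:: n]]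
  `|` [set s | exists n i : nat, (i <= n)%N /\ s = [:: n; i]].

Definition tree_at (k : nat) (L : set nat) : set (seq nat) :=
  [set [::]; [:: k]] `|` [set [:: k; i] | i in L].

Definition presents (k : nat -> nat) (L : nat -> set nat)
    (X : set (seq nat)) : Prop :=
  [/\ {homo k : m n / (m < n)%N},
      forall n, L n `<=` [set i | (i <= k n)%N],
      forall n, (L n #= `I_n.+1)%card &
      X = [set [::]] `|`
          \bigcup_n ([set [:: k n]] `|` [set [:: k n; i] | i in L n])].

Definition in_R1 (X : set (seq nat)) : Prop :=
  X `<=` TT /\ exists k L, presents k L X.

Record R1 := MkR1 { R1_set :> set (seq nat); R1_setP : in_R1 R1_set }.

HB.instance Definition _ := gen_eqMixin R1.
HB.instance Definition _ := gen_choiceMixin R1.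

Lemma R1_presentation (X : R1) :
  exists kL : (nat -> nat) * (nat -> set nat), presents kL.1 kL.2 X.
Proof. by have [_ [k [L ?]]] := R1_setP X; exists (k, L). Qed.

(** The sequences (k_n) and (L_n) are obtained by choice; they are uniquely
    determined by X, see [presents_uniq]. *)
Definition R1_k (X : R1) : nat -> nat := (projT1 (cid (R1_presentation X))).1.
Definition R1_L (X : R1) : nat -> set nat :=
  (projT1 (cid (R1_presentation X))).2.

(** usually written X(n) *)
Definition R1_tree (X : R1) (n : nat) : set (seq nat) :=
  tree_at (R1_k X n) (R1_L X n).

Definition r (n : nat) (X : R1) : set (seq nat) :=
  \bigcup_(i in [set i | (i < n)%N]) R1_tree X i.

Definition ARn (n : nat) : set (set (seq nat)) := range (r n).
Definition AR : set (set (seq nat)) := \bigcup_n ARn n.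

Definition R1_le (Y X : R1) : Prop := R1_set Y `<=` R1_set X.

Definition initial (a : set (seq nat)) (X : R1) : Prop := exists n, a = r n X.

(** usually written [a, B] *)
Definition basic (a : set (seq nat)) (B : R1) : set R1 :=
  [set X | initial a X /\ R1_le X B].

Lemma R1_kLP (X : R1) : presents (R1_k X) (R1_L X) X.
Proof. exact: projT2 (cid (R1_presentation X)). Qed.

Lemma homo_seg_uniq (f g : nat -> nat) (D E : set nat) :
  {homo f : m n / (m < n)%N} -> {homo g : m n / (m < n)%N} ->
  (forall m n, (m <= n)%N -> D n -> D m) ->
  (forall m n, (m <= n)%N -> E n -> E m) ->
  f @` D = g @` E -> D = E /\ forall i, D i -> f i = g i.
Proof.
have inj (h : nat -> nat) : {homo h : m n / (m < n)%N} ->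
    forall i j, h i = h j -> i = j.
  move=> hh i j hij; case: (ltngtP i j) => // /hh; by rewrite hij ltnn.
have le (h : nat -> nat) : {homo h : m n / (m < n)%N} ->
    forall i j, (i <= j)%N -> (h i <= h j)%N.
  by move=> hh i j; rewrite leq_eqVlt => /orP[/eqP->//|/hh/ltnW].
move=> fh gh Dd Ed fg.
have agree i : D i -> E i -> f i = g i.
  elim/ltn_ind: i => i IH Di Ei.
  have [j Ej gj] : (g @` E) (f i) by rewrite -fg; exists i.
  have [l Dl fl] : (f @` D) (g i) by rewrite fg; exists i.
  have ij : (i <= j)%N.
    rewrite leqNgt; apply/negP => ji.
    have := IH _ ji (Dd _ _ (ltnW ji) Di) Ej.
    by rewrite gj => /(inj _ fh) jE; rewrite jE ltnn in ji.
  have il : (i <= l)%N.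
    rewrite leqNgt; apply/negP => li.
    have := IH _ li Dl (Ed _ _ (ltnW li) Ei).
    by rewrite fl => /(inj _ gh) lE; rewrite -lE ltnn in li.
  by apply/eqP; rewrite eqn_leq -{1}fl -{2}gj !le.
have DE : D = E.
  apply/seteqP; split=> i.
    elim/ltn_ind: i => i IH Di.
    have [j Ej gj] : (g @` E) (f i) by rewrite -fg; exists i.
    case: (leqP i j) => [ij|ji]; first exact: Ed Ej.
    have := agree _ (Dd _ _ (ltnW ji) Di) Ej.
    by rewrite gj => /(inj _ fh) jE; rewrite -jE.
  elim/ltn_ind: i => i IH Ei.
  have [j Dj fj] : (f @` D) (g i) by rewrite fg; exists i.
  case: (leqP i j) => [ij|ji]; first exact: Dd Dj.
  have := agree _ Dj (Ed _ _ (ltnW ji) Ei).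
  by rewrite fj => /(inj _ gh) jE; rewrite jE.
by split=> // i Di; apply: agree => //; rewrite -DE.
Qed.

Lemma segment_uniq (k k' : nat -> nat) (L L' : nat -> set nat) (D E : set nat) :
  {homo k : m n / (m < n)%N} -> {homo k' : m n / (m < n)%N} ->
  (forall m n, (m <= n)%N -> D n -> D m) ->
  (forall m n, (m <= n)%N -> E n -> E m) ->
  \bigcup_(n in D) tree_at (k n) (L n) = \bigcup_(n in E) tree_at (k' n) (L' n) ->
  D = E /\ forall i, D i -> k i = k' i /\ L i = L' i.
Proof.
move=> kh k'h Dd Ed eqU.
have inj (h : nat -> nat) : {homo h : m n / (m < n)%N} ->
    forall i j, h i = h j -> i = j.
  move=> hh i j hij; case: (ltngtP i j) => // /hh; by rewrite hij ltnn.
have mem1 (h : nat -> nat) M (F : set nat) x :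
    (\bigcup_(n in F) tree_at (h n) (M n)) [:: x] <-> (h @` F) x.
  split=> [[n Fn [[//|[->]]|[i _ //]]]|[n Fn <-]]; first by exists n.
  by exists n => //; left; right.
have mem2 (h : nat -> nat) M (F : set nat) n i : {homo h : m n / (m < n)%N} ->
    F n -> (\bigcup_(n in F) tree_at (h n) (M n)) [:: h n; i] <-> M n i.
  move=> hh Fn; split=> [[m Fm [[//|//]|[j Mj [/(inj _ hh) <- <-]//]]]|Mi].
  by exists n => //; right; exists i.
have [DE kk'] : D = E /\ forall i, D i -> k i = k' i.
  apply: homo_seg_uniq => //; apply/seteqP; split=> x.
    by move=> /(mem1 k L); rewrite eqU => /mem1.
  by move=> /(mem1 k' L'); rewrite -eqU => /mem1.
split=> // i Di; split; first exact: kk'.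
apply/seteqP; split=> j.
  move=> /(mem2 _ _ _ _ _ kh Di); rewrite eqU kk' // => /mem2; apply => //.
  by rewrite -DE.
move=> Lj; apply/(mem2 _ _ _ _ _ kh Di); rewrite eqU kk' //; apply/mem2 => //.
by rewrite -DE.
Qed.

Lemma presents_bigcup k L X : presents k L X ->
  X = \bigcup_(n in setT) tree_at (k n) (L n).
Proof.
move=> [_ _ _ ->]; apply/seteqP; split=> s.
  move=> [->|[n _ [->|[i Li <-]]]]; first by exists 0%N => //; left; left.
    by exists n => //; left; right.
  by exists n => //; right; exists i.
move=> [n _ [[->|->]|[i Li <-]]]; first by left.
  by right; exists n => //; left.
by right; exists n => //; right; exists i.
Qed.

Lemma presents_uniq k L k' L' X : presents k L X -> presents k' L' X ->
  k = k' /\ L = L'.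
Proof.
move=> P P'; have [kh _ _ _] := P; have [k'h _ _ _] := P'.
have eqU : \bigcup_(n in setT) tree_at (k n) (L n) =
           \bigcup_(n in setT) tree_at (k' n) (L' n).
  by rewrite -(presents_bigcup P) -(presents_bigcup P').
have [//|//|_ e] := segment_uniq kh k'h _ _ eqU.
by split; apply/funext => i; have [] := e i I.
Qed.

Lemma r_inj (X Y : R1) m n : r m X = r n Y ->
  m = n /\ forall i, (i < m)%N -> R1_k X i = R1_k Y i /\ R1_L X i = R1_L Y i.
Proof.
move=> e; have [kX _ _ _] := R1_kLP X; have [kY _ _ _] := R1_kLP Y.
have [| |mn e'] := segment_uniq kX kY _ _ e.
- by move=> i j /= ij; apply: leq_ltn_trans.
- by move=> i j /= ij; apply: leq_ltn_trans.
split=> //; apply/eqP; rewrite eqn_leq; apply/andP; split.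
  case: m mn {e e'} => // m /seteqP[/(_ m) + _].
  by move=> /(_ (ltnSn m)).
by case: n mn {e e'} => // n /seteqP[_ /(_ n (ltnSn n))].
Qed.

Lemma r_prefix (X Y : R1) p m n : r m X = r n Y -> (p <= m)%N -> r p X = r p Y.
Proof.
move=> /r_inj[_ e] pm; apply: eq_bigcupr => i /= ip.
by rewrite /R1_tree; have [-> ->] := e i (leq_trans ip pm).
Qed.

Definition ellentuck_base : set (set R1) :=
  [set U | exists a B, AR a /\ U = basic a B].

Lemma ellentuck_cover : \bigcup_(U in ellentuck_base) U = setT.
Proof.
apply/seteqP; split=> // X _; exists (basic (r 0 X) X).
  by exists (r 0 X), X; split=> //; exists 0%N => //; exists X.
by split=> //; exists 0%N.
Qed.

Lemma ellentuck_join (U V : set R1) (X : R1) :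
  ellentuck_base U -> ellentuck_base V -> U X -> V X ->
  exists W, [/\ ellentuck_base W, W X & W `<=` U `&` V].
Proof.
move=> [a [B [_ ->]]] [b [C [_ ->]]] [[n ->] XB] [[m ->] XC].
exists (basic (r (maxn n m) X) X); split.
- exists (r (maxn n m) X), X; split=> //.
  by exists (maxn n m) => //; exists X.
- by split=> //; exists (maxn n m).
- move=> Y [[j e] YX]; split; split; try exact: subset_trans YX _.
    by exists n; apply: r_prefix e _; rewrite leq_maxl.
  by exists m; apply: r_prefix e _; rewrite leq_maxr.
Qed.

HB.instance Definition _ := @isBaseTopological.Build R1
  (set R1) ellentuck_base id ellentuck_cover ellentuck_join.

Lemma ellentuck_openP (O : set R1) : open O <->
  exists2 F : set (set R1), F `<=` ellentuck_base & \bigcup_(U in F) U = O.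
Proof. by []. Qed.

Definition nowhere_dense (T : topologicalType) (A : set T) : Prop :=
  interior (closure A) = set0.

Definition meager (T : topologicalType) (A : set T) : Prop :=
  exists2 F : nat -> set T, forall n, nowhere_dense (F n) & A = \bigcup_n F n.

Definition property_of_Baire (T : topologicalType) (A : set T) : Prop :=
  exists2 O : set T, open O & meager ((A `\` O) `|` (O `\` A)).

Definition Ramsey (X : set R1) : Prop :=
  forall a A, AR a -> basic a A !=set0 ->
    exists2 B, basic a A B & basic a B `<=` X \/ basic a B `&` X = set0.

Definition Ramsey_null (X : set R1) : Prop :=
  forall a A, AR a -> basic a A !=set0 ->
    exists2 B, basic a A B & basic a B `&` X = set0.

(* Main.v *)
Require Import Defs.
From mathcomp Require Import all_boot all_classical topology.

(** Write [[n, A]] for the neighbourhood of [A] given by [r n A]. Fusion: a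
    property [P n a S] that passes to smaller [S] and can be achieved, for any
    [X], by shrinking [[n, X]] around [r n X], can be achieved simultaneously
    for all finite approximations of some [B] in [[n, A]]; at stage [m] one
    treats the finitely many approximations whose last tree lies in the [m]-th
    tree, so that refining the tail of [A] affects all their extensions.
    For an open set [O], fuse first "[a, B] is contained in [O], or no
    refinement is", then the pigeonhole principle for one-tree extensions
    (finite Ramsey theorem) applied to the colour "[B] rejects [a]": if [B]
    rejects [r n B], some [C] rejects all approximations of its members, and
    openness of [O] makes [[n, C]] disjoint from [O]. Hence a nowhere dense set
    can be avoided, a meager set is avoided by one more fusion, and the property
    of Baire reduces to the open case. *)

Local Open Scope classical_set_scope.

(** * Finite sets as sequences, and the finite Ramsey theorem *)

Lemma card_seqP (T : choiceType) (A : set T) (n : nat) :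
  (A #= `I_n)%card <-> exists s : seq T, [/\ uniq s, size s = n & A = [set` s]].
Proof.
split=> [An|[s [us <- ->]] {n A}].
  exists (finmap.enum_fset (fset_set A)); split.
  - exact: finmap.fset_uniq.
  - exact: card_fset_set.
  - have Afin : finite_set A by apply/finite_setP; exists n.
    by rewrite -[LHS]fset_setK.
elim: s us => [_|x s IHs /= /andP[xs us]].
  by rewrite set_nil II0 card_eq00.
apply/eq_cardSP; exists x; first exact: mem_head.
rewrite (_ : _ `\ x = [set` s]); first exact: IHs.
apply/seteqP; split=> y /=; rewrite inE.
  by move=> [/orP[/eqP->//|]].
by move=> ys; split; [rewrite ys orbT|move=> yx; rewrite -yx ys in xs].
Qed.

Lemma card_subset (T : choiceType) (A : set T) (m n : nat) :
  (A #= `I_n)%card -> (m <= n)%N -> exists2 B, B `<=` A & (B #= `I_m)%card.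
Proof.
move=> /card_seqP[s [us sn ->]] mn; exists [set` take m s].
  by move=> x /= /mem_take.
by apply/card_seqP; exists (take m s); rewrite take_uniq // size_takel ?sn.
Qed.

Lemma finite_subsets (T : eqType) (A : set T) :
  finite_set A -> finite_set [set B | B `<=` A].
Proof.
move=> /finite_seqP[s ->].
apply: (@sub_finite_set _ _
  ((fun m : (size s).-tuple bool => [set` mask m s]) @` setT)); last first.
  exact/finite_image/finite_finset.
move=> B /= Bs; exists [tuple of map (fun x => `[<B x>]) (in_tuple s)] => //.
rewrite /= -filter_mask; apply/seteqP; split=> x /=; rewrite mem_filter.
  by move=> /andP[/asboolP].
by move=> Bx; rewrite (asboolT Bx) /=; exact: Bs.
Qed.

Definition homogeneous (T : eqType) (d : nat) (c : pred (seq T)) (b : bool)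
    (h : seq T) :=
  forall u, subseq u h -> size u = d -> c u = b.

Lemma homogeneous_cons (T : eqType) d (c : pred (seq T)) b x h :
  homogeneous T d (fun u => c (x :: u)) b h -> homogeneous T d.+1 c b h ->
  homogeneous T d.+1 c b (x :: h).
Proof.
move=> hx hh [//|y u] /=; case: eqP => [->|_] uh [su]; first exact: hx.
by apply: hh; rewrite //= su.
Qed.

Lemma homogeneous_subseq (T : eqType) d (c : pred (seq T)) b s h :
  subseq h s -> homogeneous T d c b s -> homogeneous T d c b h.
Proof. by move=> hs H u uh; apply: H; exact: subseq_trans uh hs. Qed.

(** Induction on [d], then on [a + b]: the separate targets for the two colours let one of them drop
    by one whenever a head [x] is set aside. *)
Lemma finite_Ramsey (T : eqType) (d a b : nat) : exists R, forall (s : seq T),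
  (R <= size s)%N -> forall c : pred (seq T),
  exists2 h, subseq h s &
    homogeneous T d c true h /\ size h = a \/
    homogeneous T d c false h /\ size h = b.
Proof.
elim: d a b => [|d IHd] a b.
  exists (maxn a b) => s; rewrite geq_max => /andP[sa sb] c.
  have c0 e n : c [::] = e -> homogeneous T 0 c e (take n s).
    by move=> ce u _ /size0nil ->.
  case E: (c [::]).
    exists (take a s); first exact: take_subseq.
    by left; rewrite size_takel //; split=> //; exact: c0.
  exists (take b s); first exact: take_subseq.
  by right; rewrite size_takel //; split=> //; exact: c0.
have hnil c e : homogeneous T d.+1 c e [::] by move=> u /eqP ->.
have [n] := ubnP (a + b); elim: n a b => // n IHn a b.
case: a => [|a] abn.
  by exists 0%N => s _ c; exists [::]; [exact: sub0seq|left].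
case: b abn => [|b] abn.
  by exists 0%N => s _ c; exists [::]; [exact: sub0seq|right].
have [|R1 HR1] := IHn a b.+1; first by rewrite -ltnS.
have [|R2 HR2] := IHn a.+1 b; first by rewrite -ltnS addnS in abn *.
(* The tail is first made homogeneous for the colouring [c (x :: u)]. The bound [maxn R1 R2] leaves
   it long enough for either induction hypothesis, whichever colour occurs. *)
have [R HR] := IHd (maxn R1 R2) (maxn R1 R2).
exists R.+1 => -[//|x s]; rewrite ltnS => Rs c.
have [h hs] := HR s Rs (fun u => c (x :: u)).
have sub h' : subseq h' h -> subseq h' (x :: s).
  by move=> /subseq_trans; apply; apply: subseq_trans hs (subseq_cons _ _).
have subx h' : subseq h' h -> subseq (x :: h') (x :: s).
  by move=> h'h; rewrite /= eqxx; exact: subseq_trans hs.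
move=> [[hx sh]|[hx sh]].
- have [|h' h'h [[H H']|H]] := HR1 h _ c; first by rewrite sh leq_maxl.
    exists (x :: h'); first exact: subx.
    left; rewrite /= H'; split=> //; apply: homogeneous_cons H.
    exact: homogeneous_subseq hx.
  by exists h'; [exact: sub|right].
- have [|h' h'h [H|[H H']]] := HR2 h _ c; first by rewrite sh leq_maxr.
    by exists h'; [exact: sub|left].
  exists (x :: h'); first exact: subx.
  right; rewrite /= H'; split=> //; apply: homogeneous_cons H.
  exact: homogeneous_subseq hx.
Qed.

Lemma finite_Ramsey_set (d n : nat) : exists R, forall A : set nat,
  (A #= `I_R)%card -> forall c : set nat -> Prop,
  exists H, [/\ H `<=` A, (H #= `I_n)%card &
    (forall U, U `<=` H -> (U #= `I_d)%card -> c U) \/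
    (forall U, U `<=` H -> (U #= `I_d)%card -> ~ c U)].
Proof.
have [R HR] := finite_Ramsey nat d n n; exists R => A /card_seqP[s [us sR ->]] c.
have [|h hs H] := HR s _ (fun u => `[< c [set` u] >]); first by rewrite sR.
have uh := subseq_uniq hs us.
have sub U : U `<=` [set` h] -> (U #= `I_d)%card ->
    exists u, [/\ subseq u h, size u = d & U = [set` u]].
  (* [u] lists the elements of [v] in the order of [h], which makes it a subsequence. *)
  move=> Uh /card_seqP[v [uv vd UE]]; pose u := [seq x <- h | x \in v].
  have uvE : u =i v.
    move=> x; rewrite mem_filter; case xv : (x \in v) => //=.
    by apply: Uh; rewrite UE.
  exists u; split; first exact: filter_subseq.
    by rewrite -vd; apply/perm_size/uniq_perm => //; exact: filter_uniq.
  by rewrite UE; apply/seteqP; split=> x /=; rewrite uvE.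
exists [set` h]; split.
- by move=> x /=; exact: mem_subseq.
- by apply/card_seqP; exists h; split=> //; case: H => -[].
- case: H => -[H _]; [left|right] => U Uh /(sub _ Uh)[u [u1 u2 ->]].
    by apply/asboolP; exact: H.
  by apply/asboolPn; rewrite (H u).
Qed.

(** * Stems, leaves and the order, tree by tree *)

Lemma R1_k_ltn (X : R1) i j : (R1_k X i < R1_k X j)%N = (i < j)%N.
Proof.
have [kh _ _ _] := R1_kLP X.
case: (ltngtP i j) => [/kh//|/kh|->]; last by rewrite ltnn.
by move=> /ltnW; rewrite leqNgt => /negbTE.
Qed.

Lemma R1_k_inj (X : R1) : injective (R1_k X).
Proof.
move=> i j e; case: (ltngtP i j) => //; rewrite -(R1_k_ltn X) e ltnn //.
Qed.

Lemma R1_k_ge (X : R1) i : (i <= R1_k X i)%N.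
Proof.
by elim: i => // i /leq_ltn_trans; apply; rewrite R1_k_ltn.
Qed.

Lemma R1_L_card (X : R1) i : (R1_L X i #= `I_i.+1)%card.
Proof. by have [] := R1_kLP X. Qed.

Lemma R1_L_le (X : R1) i : R1_L X i `<=` [set x | (x <= R1_k X i)%N].
Proof. by have [] := R1_kLP X. Qed.

Lemma R1_make (k : nat -> nat) (L : nat -> set nat) :
  (forall i, (k i < k i.+1)%N) ->
  (forall i, L i `<=` [set x | (x <= k i)%N]) ->
  (forall i, (L i #= `I_i.+1)%card) ->
  exists X : R1, R1_k X = k /\ R1_L X = L.
Proof.
move=> kS Lk Lcard.
pose S := [set [::]] `|`
  \bigcup_n ([set [:: k n]] `|` [set [:: k n; i] | i in L n]).
have PS : presents k L S by split=> //; apply: homo_ltn => // ? ? ?; exact: ltn_trans.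
have inS : in_R1 S.
  split; last by exists k, L.
  move=> s [->|[n _ [->|[i Li <-]]]]; first by left; left.
    by left; right; exists (k n).
  by right; exists (k n), i; split=> //; exact: Lk.
by exists (MkR1 inS); exact: presents_uniq (R1_kLP (MkR1 inS)) PS.
Qed.

Definition subtree (Y : R1) (i : nat) (X : R1) (j : nat) : Prop :=
  R1_k Y i = R1_k X j /\ R1_L Y i `<=` R1_L X j.

Lemma subtree_trans (X Y Z : R1) i j l :
  subtree X i Y j -> subtree Y j Z l -> subtree X i Z l.
Proof.
move=> [k1 s1] [k2 s2]; split; [by rewrite k1|exact: subset_trans s2].
Qed.

(** A stem occurs in only one tree of [X], so the node [[:: R1_k Y i]] already decides which tree of
    [X] receives all the leaves of tree [i]. Arbitrary index sets cover both approximations and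
    whole members. *)
Lemma bigcup_R1_treeP (X Y : R1) (D E : set nat) :
  \bigcup_(i in D) R1_tree Y i `<=` \bigcup_(j in E) R1_tree X j <->
  forall i, D i -> exists2 j, E j & subtree Y i X j.
Proof.
split=> [YX i Di|YX s [i /YX[j Ej [kE Lsub]] t]].
  have [|j Ej kE] := YX [:: R1_k Y i]; first by exists i => //; left; right.
  have {}kE : R1_k Y i = R1_k X j by case: kE => [[//|[]]|[]].
  exists j => //; split=> // x Lx.
  have [|l El lE] := YX [:: R1_k Y i; x].
    by exists i => //; right; exists x.
  by case: lE => [[//|//]|[y Ly []]]; rewrite kE => /R1_k_inj <- <-.
exists j => //; case: t => [[->|->]|[x Lx <-]].
- by left; left.
- by left; right; rewrite kE.
- by right; rewrite kE; exists x => //; exact: Lsub.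
Qed.

Lemma R1_leP (Y X : R1) : R1_le Y X <-> forall i, exists j, subtree Y i X j.
Proof.
rewrite /R1_le (presents_bigcup (R1_kLP X)) (presents_bigcup (R1_kLP Y)).
split=> [/bigcup_R1_treeP H i|H]; first by have [//|j _ ?] := H i; exists j.
by apply/bigcup_R1_treeP => i _; have [j ?] := H i; exists j.
Qed.

Lemma R1_le_trans (X Y Z : R1) : R1_le X Y -> R1_le Y Z -> R1_le X Z.
Proof. exact: subset_trans. Qed.

Lemma r_eqP (n : nat) (X Y : R1) : r n X = r n Y <->
  forall i, (i < n)%N -> R1_k X i = R1_k Y i /\ R1_L X i = R1_L Y i.
Proof.
split=> [/r_inj[]//|H]; apply: eq_bigcupr => i /= /H[e1 e2].
by rewrite /R1_tree e1 e2.
Qed.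

Lemma r_subtree (n i : nat) (X Y : R1) :
  r n X = r n Y -> (i < n)%N -> subtree X i Y i.
Proof. by move=> /r_eqP XY /XY[kE LE]; split=> //; rewrite LE. Qed.

Lemma r_le (m n : nat) (X Y : R1) : (m <= n)%N -> r n X = r n Y -> r m X = r m Y.
Proof. by move=> mn e; exact: r_prefix e mn. Qed.

Lemma basicP (n : nat) (X A Y : R1) :
  basic (r n X) A Y <-> r n Y = r n X /\ R1_le Y A.
Proof.
split=> [[[m e] YA]|[e YA]]; last by split=> //; exists n.
by have [mn _] := r_inj e; split=> //; rewrite e mn.
Qed.

Lemma basic_refl (n : nat) (X : R1) : basic (r n X) X X.
Proof. by apply/basicP; split. Qed.

Lemma sub_basic a (A B : R1) : R1_le B A -> basic a B `<=` basic a A.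
Proof. by move=> BA Y [aY YB]; split=> //; exact: R1_le_trans BA. Qed.

(** * Building members of $\mathcal{R}_1$, and the pigeonhole principle *)

(** Trees are chosen recursively; since admissible stems exist above every [M], each can be taken
    beyond the previous one. *)
Lemma R1_extend (X : R1) (p : nat) (T : nat -> nat -> set nat -> Prop) :
  (forall i M, (p <= i)%N -> exists k L, [/\ (M <= k)%N,
     L `<=` [set x | (x <= k)%N], (L #= `I_i.+1)%card & T i k L]) ->
  exists C, r p C = r p X /\ forall i, (p <= i)%N -> T i (R1_k C i) (R1_L C i).
Proof.
move=> H.
have /choice[f fP] (iM : nat * nat) : exists kL : nat * set nat,
    (p <= iM.1)%N -> [/\ (iM.2 <= kL.1)%N, kL.2 `<=` [set x | (x <= kL.1)%N],
      (kL.2 #= `I_iM.1.+1)%card & T iM.1 kL.1 kL.2].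
  have [pi|pi] := leqP p iM.1; last by exists (0%N, set0).
  by have [k [L HkL]] := H iM.1 iM.2 pi; exists (k, L).
pose h i M := if (i < p)%N then (R1_k X i, R1_L X i) else f (i, M).
pose g := fix g i := if i is i'.+1 then h i (g i').1.+1 else h 0%N 0%N.
have hf i M : (p <= i)%N -> h i M = f (i, M) by rewrite /h ltnNge => ->.
have gX i : (i < p)%N -> g i = (R1_k X i, R1_L X i).
  by case: i => [|i] ip /=; rewrite /h ip.
have gf i : (p <= i)%N -> exists M, g i = f (i, M).
  by case: i => [|i] ip /=; rewrite hf //; eexists.
have [|i|i|C [Ck CL]] := R1_make (fun i => (g i).1) (fun i => (g i).2).
- move=> i; have [ip|ip] := ltnP i.+1 p.
    by rewrite !gX ?R1_k_ltn // ltnW.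
  by rewrite /= hf //; have [] := fP (i.+1, (g i).1.+1) ip.
- have [/gX->|ip] := ltnP i p; first exact: R1_L_le.
  by have [M ->] := gf i ip; have [] := fP (i, M) ip.
- have [/gX->|ip] := ltnP i p; first exact: R1_L_card.
  by have [M ->] := gf i ip; have [] := fP (i, M) ip.
exists C; rewrite Ck CL; split.
  by apply/r_eqP => i ip; rewrite Ck CL gX.
by move=> i ip; have [M ->] := gf i ip; have [] := fP (i, M) ip.
Qed.

Lemma R1_graft (X B : R1) (p : nat) : exists2 C, r p C = r p X &
  forall i, (p <= i)%N -> exists j, subtree C i B j.
Proof.
have [|C [CX CB]] := R1_extend X p
  (fun _ k L => exists j, k = R1_k B j /\ L `<=` R1_L B j).
  (* Tree [maxn i M] of [B] has at least [i.+1] leaves and its stem is at least [M]. *)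
  move=> i M pi; have [|L LB Lc] := @card_subset _ _ i.+1 _ (R1_L_card B (maxn i M)).
    by rewrite ltnS leq_maxl.
  exists (R1_k B (maxn i M)), L; split=> //.
  - exact: leq_trans (leq_maxr _ _) (R1_k_ge _ _).
  - by apply: subset_trans LB _; exact: R1_L_le.
  - by exists (maxn i M).
by exists C => // i /CB.
Qed.

Lemma pigeonhole (chi : set (seq nat) -> Prop) (X : R1) (p : nat) :
  exists2 C, basic (r p X) X C &
    (forall Z, basic (r p X) C Z -> chi (r p.+1 Z)) \/
    (forall Z, basic (r p X) C Z -> ~ chi (r p.+1 Z)).
Proof.
pose c (e : bool) k L := if e then chi (r p X `|` tree_at k L)
                         else ~ chi (r p X `|` tree_at k L).
pose hom e m H := forall U, U `<=` H -> (U #= `I_p.+1)%card -> c e (R1_k X m) U.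
(* [G e]: arbitrarily late trees of [X] carry arbitrarily large leaf sets of colour [e]. The subsets
   coloured in [hom] have [p.+1] elements because tree [p] of any [Z] has [p.+1] leaves. Either
   colour with [G e] suffices to build [C]. *)
pose G e := forall i M, exists m H,
  [/\ (M <= m)%N, H `<=` R1_L X m, (H #= `I_i.+1)%card & hom e m H].
have rS Z : r p Z = r p X -> r p.+1 Z = r p X `|` tree_at (R1_k Z p) (R1_L Z p).
  move=> <-; apply/seteqP; split=> s.
    move=> [i /=]; rewrite ltnS leq_eqVlt => /orP[/eqP->|ip] t; first by right.
    by left; exists i.
  by move=> [[i /= ip t]|t]; [exists i => //=; exact: ltnW|exists p => /=].
suff [e Ge] : exists e, G e.
  have [|C [CX CT]] := R1_extend X p (fun i k L =>
      exists m, [/\ k = R1_k X m, L `<=` R1_L X m & hom e m L]).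
    move=> i M _; have [m [H [Mm HX Hc Hh]]] := Ge i M.
    exists (R1_k X m), H; split=> //; first exact: leq_trans Mm (R1_k_ge _ _).
      by apply: subset_trans HX _; exact: R1_L_le.
    by exists m.
  have cC Z : basic (r p X) C Z -> c e (R1_k Z p) (R1_L Z p).
    move=> /basicP[ZX /R1_leP/(_ p)[j [kE Lsub]]].
    have [jp|pj] := ltnP j p.
      (* Tree [p] of [Z] cannot come from the first [p] trees of [C], whose stems [Z] already
         uses. *)
      have /r_eqP/(_ j jp)[kE' _] : r p C = r p Z by rewrite CX ZX.
      by move: kE; rewrite kE' => /R1_k_inj pj; rewrite -pj ltnn in jp.
    have [m [kX _ Hh]] := CT j pj.
    by rewrite kE kX; apply: Hh => //; exact: R1_L_card.
  exists C; first apply/basicP; first split=> //.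
    apply/R1_leP => i; have [ip|pi] := ltnP i p.
      by exists i; apply: r_subtree CX ip.
    by have [m [? ? _]] := CT i pi; exists m.
  case: e {Ge CT} cC => cC; [left|right] => Z ZC;
    by have /basicP[ZX _] := ZC; rewrite rS //; exact: cC ZC.
apply: contrapT => noG.
have notG e : exists i M, forall m H, (M <= m)%N -> H `<=` R1_L X m ->
    (H #= `I_i.+1)%card -> ~ hom e m H.
  apply: contrapT => He; apply: noG; exists e => i M.
  apply: contrapT => Hn; apply: He; exists i, M => m H ? ? ? ?.
  by apply: Hn; exists m, H.
have [i1 [M1 N1]] := notG true; have [i2 [M2 N2]] := notG false.
have [R HR] := finite_Ramsey_set p.+1 (maxn i1 i2).+1.
(* [R] provides enough leaves for the Ramsey theorem, while [M1] and [M2] place tree [m] where the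
   failures of both colours apply. *)
pose m := maxn R (maxn M1 M2).
have [|A AX Ac] := @card_subset _ _ R _ (R1_L_card X m).
  by rewrite leqW // leq_maxl.
have [H [HA Hc HH]] := HR A Ac (fun U => chi (r p X `|` tree_at (R1_k X m) U)).
have shrink i : (i <= maxn i1 i2)%N -> exists2 H', H' `<=` H & (H' #= `I_i.+1)%card.
  by move=> ile; apply: card_subset Hc _.
case: HH => HH.
  have [H' H'H H'c] := shrink i1 (leq_maxl _ _).
  apply: (N1 m H') => //; first by rewrite /m maxnCA leq_maxl.
    by apply: subset_trans H'H (subset_trans HA AX).
  by move=> U UH' Uc; apply: HH => //; exact: subset_trans UH' H'H.
have [H' H'H H'c] := shrink i2 (leq_maxr _ _).
apply: (N2 m H') => //; first by rewrite /m maxnA leq_maxr.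
  by apply: subset_trans H'H (subset_trans HA AX).
by move=> U UH' Uc; apply: HH => //; exact: subset_trans UH' H'H.
Qed.

(** * Depth of an approximation, and fusion *)

(* [p] trees of [X] and [m] trees of [A] have the same last stem; together with
   [r p X `<=` r m A] this says that [r p X] has depth [m] in [A]. *)
Definition same_end (p : nat) (X : R1) (m : nat) (A : R1) : Prop :=
  match p, m with
  | 0, 0 => True
  | p'.+1, m'.+1 => R1_k X p' = R1_k A m'
  | _, _ => False
  end.

(** Stems increase, so every tree of [Y] from index [p] on has its stem beyond the common last one.
    Hence extensions of [r p X] only see the tail of [B]. *)
Lemma same_end_ltn p X m A (Y B : R1) i j : same_end p X m A ->
  r p Y = r p X -> r m B = r m A -> (p <= i)%N -> R1_k Y i = R1_k B j ->
  (m <= j)%N.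
Proof.
case: p m => [|p] [|m] //= XA /r_eqP/(_ p (ltnSn p))[YX _].
move=> /r_eqP/(_ m (ltnSn m))[BA _] pi kE.
by rewrite -(R1_k_ltn B) -kE BA -XA -YX R1_k_ltn.
Qed.

Lemma same_end_r p X m A A' : r m A' = r m A -> same_end p X m A ->
  same_end p X m A'.
Proof.
by case: p m => [|p] [|m] //= /r_eqP/(_ m (ltnSn m))[-> _].
Qed.

Lemma r_finite m A : finite_set (r m A).
Proof.
apply: bigcup_finite => [|i _]; first exact: finite_II.
rewrite /R1_tree /tree_at finite_setU; split; first exact: finite_set2.
by apply: finite_image; apply/finite_setP; eexists; exact: R1_L_card.
Qed.

Section fusion.
Variable P : nat -> set (seq nat) -> set R1 -> Prop.
Hypothesis P_sub : forall p a S S', S' `<=` S -> P p a S -> P p a S'.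
Hypothesis P_dense : forall p X,
  exists2 B, basic (r p X) X B & P p (r p X) (basic (r p X) B).

(** Shrink around [r p X] to some [B], then put the tail of [B] back behind [r m A]. By
    [same_end_ltn], the members of [basic (r p X) A'] draw their new trees from that tail, so they
    lie below [B]. *)
Lemma fusion_step1 (A X : R1) (p m : nat) :
  r p X `<=` r m A -> same_end p X m A ->
  exists2 A', basic (r m A) A A' & P p (r p X) (basic (r p X) A').
Proof.
move=> /bigcup_R1_treeP XA XAend.
have [X' X'X X'A] := R1_graft X A p.
have {}X'A : R1_le X' A.
  apply/R1_leP => i; have [ip|/X'A//] := ltnP i p.
  have [j _ ij] := XA i ip; exists j.
  exact: subtree_trans (r_subtree _ _ _ _ X'X ip) ij.
have [B /basicP[BX' BX] PB] := P_dense p X'; rewrite X'X in PB.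
have [A' A'A A'B] := R1_graft A B m.
exists A'.
  apply/basicP; split=> //; apply/R1_leP => i.
  have [im|mi] := ltnP i m.
    by exists i; apply: r_subtree A'A im.
  have [j ij] := A'B i mi.
  have /R1_leP/(_ j)[l jl] := R1_le_trans _ _ _ BX X'A.
  by exists l; exact: subtree_trans jl.
apply: P_sub PB => Y /basicP[YX YA']; rewrite -X'X in YX *.
apply/basicP; split=> //; apply/R1_leP => i.
have [ip|pi] := ltnP i p.
  by exists i; apply: r_subtree ip; rewrite YX BX'.
have /R1_leP/(_ i)[j ij] := YA'.
have mj : (m <= j)%N.
  by apply: same_end_ltn XAend _ A'A pi ij.1; rewrite YX.
by have [l jl] := A'B j mj; exists l; exact: subtree_trans jl.
Qed.

(** [r m A] is finite, so the approximations inside it can be treated one after another; each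
    refinement keeps [r m A], and [P_sub] preserves what was achieved. *)
Lemma fusion_step (A : R1) (m : nat) : exists2 A', basic (r m A) A A' &
  forall p X, r p X `<=` r m A -> same_end p X m A ->
    P p (r p X) (basic (r p X) A').
Proof.
have /finite_seqP[l lE] := finite_subsets _ _ (r_finite m A).
suff [A' A'A H] : exists2 A', basic (r m A) A A' & forall p X,
    r p X \in l -> r p X `<=` r m A -> same_end p X m A ->
    P p (r p X) (basic (r p X) A').
  exists A' => // p X XA; apply: H => //.
  by have : [set B | B `<=` r m A] (r p X) by []; rewrite lE.
elim: l {lE} => [|a l [A1 /basicP[A1A A1le] IHl]].
  by exists A; first exact: basic_refl.
have [[p [X [ra XA XAend]]]|no] := pselect
  (exists p X, [/\ r p X = a, r p X `<=` r m A & same_end p X m A]); last first.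
  exists A1 => [|p X]; first exact/basicP.
  rewrite inE => /orP[/eqP e|]; last exact: IHl.
  by move=> XA XAend; case: no; exists p, X.
have [||A2 /basicP[A2A1 A2le] PA2] := @fusion_step1 A1 X p m.
- by rewrite A1A.
- exact: same_end_r XAend.
exists A2 => [|q Y].
  by apply/basicP; rewrite A2A1; split=> //; exact: R1_le_trans A1le.
rewrite inE => /orP[/eqP e|Yl YA YAend].
  rewrite -ra in e; have [qp _] := r_inj e.
  by rewrite qp in e *; rewrite e.
by apply: P_sub (IHl _ _ Yl YA YAend); exact: sub_basic.
Qed.

Lemma fusion (A : R1) (n : nat) : exists2 B, basic (r n A) A B &
  forall Y q, (n <= q)%N -> basic (r n B) B Y -> P q (r q Y) (basic (r q Y) B).
Proof.
have /choice[f fP] (Am : R1 * nat) : exists A', basic (r Am.2 Am.1) Am.1 A' /\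
    forall p X, r p X `<=` r Am.2 Am.1 -> same_end p X Am.2 Am.1 ->
      P p (r p X) (basic (r p X) A').
  by have [A' ? ?] := fusion_step Am.1 Am.2; exists A'.
(* Stages below [n] do nothing, which keeps [r n A] intact. *)
pose A_ := fix A_ m := if m is m'.+1 then
  (if (n <= m')%N then f (A_ m', m') else A_ m') else A.
have A_S m : r m (A_ m.+1) = r m (A_ m) /\ R1_le (A_ m.+1) (A_ m).
  have [/basicP fAm _] := fP (A_ m, m).
  by rewrite /=; case: (n <= m)%N => //; split.
have A_le m d : r m (A_ (d + m)) = r m (A_ m) /\ R1_le (A_ (d + m)) (A_ m).
  elim: d => [|d [e le]]; first by split.
  have [e' le'] := A_S (d + m); rewrite addSn; split.
    by rewrite -e; apply: r_le e'; exact: leq_addl.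
  exact: R1_le_trans le' le.
have A_r m m' : (m <= m')%N -> r m (A_ m') = r m (A_ m).
  by move=> /subnK <-; have [] := A_le m (m' - m).
have A_anti m m' : (m <= m')%N -> R1_le (A_ m') (A_ m).
  by move=> /subnK <-; have [] := A_le m (m' - m).
have A_n m : (m <= n)%N -> A_ m = A.
  by elim: m => // m IHm mn; rewrite /= leqNgt mn /= IHm // ltnW.
(* Tree [i] never changes after stage [i.+1], so the diagonal takes it from there. *)
have [|i|i|B [Bk BL]] := R1_make (fun i => R1_k (A_ i.+1) i)
    (fun i => R1_L (A_ i.+1) i).
- move=> i; have /r_eqP/(_ i (ltnSn i))[<- _] := A_r i.+1 i.+2 (leqnSn _).
  by rewrite R1_k_ltn.
- exact: R1_L_le.
- exact: R1_L_card.
have BA m : r m B = r m (A_ m).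
  by apply/r_eqP => i im; rewrite Bk BL; have /r_eqP/(_ i (ltnSn i))[-> ->] := A_r _ _ im.
have BleA m : R1_le B (A_ m).
  apply/R1_leP => i; have [im|mi] := ltnP i m.
    by exists i; apply: r_subtree (BA m) im.
  have /R1_leP/(_ i)[j] := A_anti _ _ (leqW mi).
  by rewrite /subtree Bk BL; exists j.
exists B; first by apply/basicP; split; [rewrite BA A_n|exact: (BleA 0%N)].
move=> Y q nq /basicP[YB YleB].
(* [m] is the depth of [r q Y] in [B]. It is at least [n]: otherwise the last tree of [r q Y] would
   share its stem with an earlier tree of [Y], since [Y] and [B] agree below [n]. *)
have [m [nm YsubB Yend]] : exists m, [/\ (n <= m)%N, r q Y `<=` r m B &
    same_end q Y m B].
  case: q nq => [|q] nq; first by exists 0%N; split=> // s [].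
  have /R1_leP/(_ q)[m [kE _]] := YleB; exists m.+1; split=> //.
    rewrite leqNgt; apply/negP => mn.
    have /r_eqP/(_ m (ltnW mn))[mE _] := YB.
    have mq : (m < q)%N by rewrite -ltnS; exact: leq_trans mn nq.
    by move: mq; rewrite -(R1_k_ltn Y) kE mE ltnn.
  apply/bigcup_R1_treeP => i /= iq; have /R1_leP/(_ i)[j ij] := YleB.
  exists j => //=; rewrite ltnS leqNgt -(R1_k_ltn B) -kE -ij.1 R1_k_ltn.
  by rewrite -leqNgt -ltnS.
apply: (P_sub _ _ (basic (r q Y) (A_ m.+1))); first exact/sub_basic/BleA.
rewrite /= nm; have [_] := fP (A_ m, m); apply; rewrite /= -?BA //.
by apply: same_end_r Yend; rewrite BA.
Qed.

End fusion.

(** * Open, nowhere dense and meager sets *)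

Lemma open_basicP (O : set R1) (Y : R1) n : open O -> O Y ->
  exists2 q, (n <= q)%N & basic (r q Y) Y `<=` O.
Proof.
move=> /ellentuck_openP[F Fb <-] [U FU UY].
have [a [D [_ UE]]] := Fb U FU; move: UY; rewrite UE => -[[q aE] YD].
exists (maxn n q); first exact: leq_maxl.
move=> Z /basicP[ZY ZleY]; exists U => //; rewrite UE aE.
apply/basicP; split; last exact: R1_le_trans YD.
by apply: r_le ZY; exact: leq_maxr.
Qed.

Lemma open_basic (X B : R1) n : open (basic (r n X) B).
Proof.
apply/ellentuck_openP; exists [set basic (r n X) B]; last by rewrite bigcup_set1.
by move=> _ ->; exists (r n X), B; split=> //; exists n => //; exists X.
Qed.

(* A witness [X] of [basic a A !=set0] may replace [A], because then
   [a = r n X] and [basic a X `<=` basic a A]. *)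
Lemma basic_reduction (Q : set (set R1)) :
  (forall X n, exists2 B, basic (r n X) X B & Q (basic (r n X) B)) ->
  forall a A, AR a -> basic a A !=set0 -> exists2 B, basic a A B & Q (basic a B).
Proof.
move=> H a A _ [X [[n ->] XA]]; have [B /basicP[BX BleX] QB] := H X n.
by exists B => //; apply/basicP; split=> //; exact: R1_le_trans XA.
Qed.

Lemma open_homogeneous (O : set R1) : open O -> forall A n,
  exists2 B, basic (r n A) A B &
    basic (r n A) B `<=` O \/ basic (r n A) B `&` O = set0.
Proof.
move=> Oo A n.
pose decides (p : nat) a S := S `<=` O \/ forall C, S C -> ~ basic a C `<=` O.
have [p a S S' S'S [SO|nSO]|p X|B /basicP[BA BleA] decB] := fusion decides _ _ A n.
- by left; exact: subset_trans SO.
- by right => C /S'S; exact: nSO.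
- have [[C XC CO]|no] := pselect (exists2 C, basic (r p X) X C &
    basic (r p X) C `<=` O); first by exists C => //; left.
  exists X; first exact: basic_refl.
  by right => C XC CO; apply: no; exists C.
pose rejects a := forall C, basic a B C -> ~ basic a C `<=` O.
pose mono p (a : set (seq nat)) (S : set R1) :=
  (forall Z, S Z -> rejects (r p.+1 Z)) \/ (forall Z, S Z -> ~ rejects (r p.+1 Z)).
have [p a S S' S'S [m1|m2]|p X|C /basicP[CB CleB] monoC] := fusion mono _ _ B n.
- by left=> Z /S'S; exact: m1.
- by right=> Z /S'S; exact: m2.
- exact: pigeonhole.
have [BO|Brej] := decB B n (leqnn n) (basic_refl n B).
  by exists B; [exact/basicP|left; rewrite -BA].
exists C; first by apply/basicP; rewrite CB; split=> //; exact: R1_le_trans BleA.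
right; rewrite -BA -CB; apply/seteqP; split=> // Y [YC OY].
(* Rejection climbs one tree at a time. If the one-tree extensions of [r (d + n) Z] in [C] were not
   rejected, [decB] would put their neighbourhoods inside [O], hence also [basic (r (d + n) Z) Z],
   contradicting rejection of [r (d + n) Z]. *)
have rejY q Z : (n <= q)%N -> basic (r n C) C Z -> rejects (r q Z).
  move=> /subnK <-; elim: (q - n)%N Z => {q}[|d IHd] Z ZC.
    have /basicP[-> _] := ZC; rewrite CB; exact: Brej.
  have rejd := IHd Z ZC; have /basicP[ZCr ZleC] := ZC.
  have [|mC] := monoC Z (d + n)%N (leq_addl _ _) ZC.
    by apply; exact/basicP.
  case: (rejd Z); first by apply/basicP; split=> //; exact: R1_le_trans CleB.
  move=> W /basicP[WZ WleZ]; have WleC := R1_le_trans _ _ _ WleZ ZleC.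
  have WB : basic (r n B) B W.
    apply/basicP; split; last exact: R1_le_trans CleB.
    by rewrite -CB -ZCr; apply: r_le WZ; exact: leq_addl.
  have [SO|nSO] := decB W (d + n).+1 (leqW (leq_addl _ _)) WB.
    by apply: SO; apply/basicP; split=> //; have /basicP[] := WB.
  by case: (mC W) => //; apply/basicP.
(* Openness yields a neighbourhood of [Y] inside [O], so [Y] itself witnesses that [r q Y] is not
   rejected. *)
have [q nq qO] := open_basicP O Y n Oo OY.
apply: (rejY q Y nq YC Y _ qO); apply/basicP; split=> //.
by have /basicP[_ /R1_le_trans] := YC; apply.
Qed.

Lemma nowhere_dense_avoid (F : set R1) : nowhere_dense F -> forall A n,
  exists2 B, basic (r n A) A B & basic (r n A) B `&` F = set0.
Proof.
move=> Fnd A n.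
have [|B BA BF] := open_homogeneous (~` closure F) _ A n.
  by rewrite openC; exact: closed_closure.
exists B => //; apply/seteqP; split=> // Y [YB FY].
case: BF => [/(_ _ YB)|/disjoints_subset]; first by apply; exact: subset_closure.
(* In this case the open set [basic (r n A) B] lies in the closure of [F], hence in its empty
   interior, although it contains [Y]. *)
rewrite setCK (open_subsetE _ (open_basic _ _ _)) [X in _ `<=` X]Fnd.
exact.
Qed.

Lemma meager_avoid (M : set R1) : meager M -> forall A n,
  exists2 B, basic (r n A) A B & basic (r n A) B `&` M = set0.
Proof.
move=> [F Fnd ->] A n.
(* Only finitely many [F i] are handled at each approximation, so density follows by iterating
   [nowhere_dense_avoid]. *)
pose avoids p (a : set (seq nat)) (S : set R1) :=
  forall i, (i <= p)%N -> S `&` F i = set0.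
have [p a S S' S'S H i ip|p X|B BA avB] := fusion avoids _ _ A n.
- by apply/seteqP; split=> // Y [/S'S SY FY]; rewrite -(H i ip).
- suff /(_ p.+1)[B XB H] d : exists2 B, basic (r p X) X B &
      forall i, (i < d)%N -> basic (r p X) B `&` F i = set0.
    by exists B.
  elim: d => [|d [B /basicP[BX BleX] IHd]]; first by exists X; first exact: basic_refl.
  have [C /basicP[CB CleB] CF] := nowhere_dense_avoid _ (Fnd d) B p.
  exists C; first by apply/basicP; rewrite CB; split=> //; exact: R1_le_trans BleX.
  move=> i; rewrite ltnS leq_eqVlt => /orP[/eqP->|id]; first by rewrite -BX.
  apply/seteqP; split=> // Y [YC FY].
  by rewrite -(IHd i id); split=> //; exact: sub_basic YC.
exists B => //; apply/seteqP; split=> // Y [YB [i _ FY]].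
have /basicP[BAr BleA] := BA; have /basicP[_ YleB] := YB.
(* Length [maxn n i] is long enough both for the fusion to apply and for [F i] to be among the
   avoided sets. *)
rewrite -BAr in YB; rewrite -(avB Y (maxn n i) (leq_maxl _ _) YB i (leq_maxr _ _)).
by split=> //; exact/basicP.
Qed.

Theorem theorem3p9 :
  (forall X : set R1, property_of_Baire X -> Ramsey X) /\
  (forall X : set R1, meager X -> Ramsey_null X).
Proof.
split=> X; last first.
  move=> Xm; apply: (basic_reduction (fun S => S `&` X = set0)).
  exact: meager_avoid.
move=> [O Oo /meager_avoid XO].
apply: (basic_reduction (fun S => S `<=` X \/ S `&` X = set0)) => A n.
have [B /basicP[BA BleA] BXO] := XO A n.
have [C /basicP[CB CleB] CO] := open_homogeneous O Oo B n.
(* Both differences of [X] and [O] are avoided below [B], so the two sets coincide on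
   [basic (r n A) C]. *)
have XOE Y : basic (r n A) C Y -> (X Y <-> O Y).
  move=> YC; have YB := sub_basic _ _ _ CleB _ YC.
  split=> H; apply: contrapT => nH.
    by have : set0 Y by rewrite -BXO; split=> //; left.
  by have : set0 Y by rewrite -BXO; split=> //; right.
rewrite BA in CB CO; exists C.
  by apply/basicP; split=> //; exact: R1_le_trans BleA.
case: CO => CO; [left=> Y YC|right; apply/seteqP; split=> // Y [YC XY]].
  by apply/XOE/CO.
by rewrite -CO; split=> //; apply/XOE.
Qed.
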